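(* Let $A_\Gamma$ be an Artin group such that the intersection of any two parabolic subgroups of $A_\Gamma$ is a parabolic subgroup of $A_\Gamma$ (i.e. $A_\Gamma$ is in the class $\mathcal{A}$). Then the intersection of an arbitrary family of parabolic subgroups of $A_\Gamma$ is a parabolic subgroup of $A_\Gamma$. In particular, for every subset $B\subset A_\Gamma$ there exists a unique minimal (with respect to inclusion) parabolic subgroup of $A_\Gamma$ containing $B$.
   Context: Let $\Gamma$ be a finite non-empty simplicial graph with vertex set $V(\Gamma)$, edge set $E(\Gamma)$ and an edge-labeling $m\colon E(\Gamma)\to\{2,3,4,\ldots\}$. The Artin group $A_\Gamma$ is the group with generating set $V(\Gamma)$ and relations $vwv\cdots = wvw\cdots$ (both sides alternating words with $m(\{v,w\})$ letters) for each $\{v,w\}\in E(\Gamma)$. For $X\subset V(\Gamma)$, $A_X$ denotes the subgroup of $A_\Gamma$ generated by $X$ (trivial if $X=\emptyset$). A parabolic subgroup of $A_\Gamma$ is a conjugate $gA_Xg^{-1}$ with $g\in A_\Gamma$, $X\subset V(\Gamma)$. *)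

(* Defs.v *)
From HB Require Import structures.
From mathcomp Require Import all_boot.
From mathcomp Require Import boolp classical_sets.

Set Implicit Arguments.
Unset Strict Implicit.
Unset Printing Implicit Defensive.

Local Open Scope group_scope.
Local Open Scope classical_set_scope.
Local Open Scope quotient_scope.

(* The letter [(x, true)] stands for the generator [x], and [(x, false)] for
   its formal inverse. *)
Definition word (X : Type) : Type := seq (X * bool).

Section Presentation.
Variables (X : choiceType) (R : word X -> word X -> Prop).

Inductive word_eq : word X -> word X -> Prop :=
| word_eq_refl u : word_eq u u
| word_eq_sym u v : word_eq u v -> word_eq v u
| word_eq_trans u v w : word_eq u v -> word_eq v w -> word_eq u w
| word_eq_cat u u' v v' :
    word_eq u u' -> word_eq v v' -> word_eq (u ++ v) (u' ++ v')
| word_eq_cancel x b : word_eq [:: (x, b); (x, ~~ b)] [::]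
| word_eq_rel u v : R u v -> word_eq u v.

Definition word_eqb (u v : seq (X * bool)) : bool := `[< word_eq u v >].

Lemma word_eqb_refl : reflexive word_eqb.
Proof. by move=> u; apply/asboolP; apply: word_eq_refl. Qed.

Lemma word_eqb_sym : symmetric word_eqb.
Proof. by move=> u v; apply/asboolP/asboolP; apply: word_eq_sym. Qed.

Lemma word_eqb_trans : transitive word_eqb.
Proof.
move=> v u w /asboolP uv /asboolP vw; apply/asboolP; exact: word_eq_trans vw.
Qed.

Canonical word_equiv :=
  EquivRel word_eqb word_eqb_refl word_eqb_sym word_eqb_trans.

Definition presented : Type := {eq_quot word_equiv}.
HB.instance Definition _ := Choice.on presented.

Definition word_inv (u : seq (X * bool)) : seq (X * bool) :=
  rev [seq (a.1, ~~ a.2) | a <- u].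

Lemma word_eq_invr u : word_eq (u ++ word_inv u) [::].
Proof.
elim: u => [|[x b] u IH]; first exact: word_eq_refl.
rewrite /word_inv /= rev_cons -cats1 catA -/(word_inv u).
apply: word_eq_trans (word_eq_cancel x b).
rewrite -cat1s -[[:: (x, b); _]]cat1s.
apply: (@word_eq_cat [:: (x, b)]); first exact: word_eq_refl.
rewrite -[X in word_eq _ X]cat0s; apply: word_eq_cat => //.
exact: word_eq_refl.
Qed.

Lemma word_invK : involutive word_inv.
Proof.
move=> u; rewrite /word_inv map_rev revK -map_comp -[RHS]map_id.
by apply: eq_map => -[x b] /=; rewrite negbK.
Qed.

Lemma word_eq_invl u : word_eq (word_inv u ++ u) [::].
Proof. by have := word_eq_invr (word_inv u); rewrite word_invK. Qed.

Lemma word_eq_inv u v : word_eq u v -> word_eq (word_inv u) (word_inv v).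
Proof.
move=> uv; apply: (@word_eq_trans _ (word_inv u ++ (v ++ word_inv v))).
  rewrite -[X in word_eq X _]cats0; apply: word_eq_cat.
    exact: word_eq_refl.
  exact: word_eq_sym (word_eq_invr v).
rewrite catA -[X in word_eq _ X]cat0s; apply: word_eq_cat.
  apply: word_eq_trans (word_eq_invl u); apply: word_eq_cat.
    exact: word_eq_refl.
  exact: word_eq_sym.
exact: word_eq_refl.
Qed.

Definition pres_mul (a b : presented) : presented :=
  \pi_presented (repr a ++ repr b).
Definition pres_one : presented := \pi_presented [::].
Definition pres_inv (a : presented) : presented :=
  \pi_presented (word_inv (repr a)).

Lemma pres_piP u v : word_eq u v <-> \pi_presented u = \pi_presented v.
Proof.
split=> [uv|]; first by apply/eqmodP/asboolP.
by move/eqmodP => /asboolP.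
Qed.

Lemma pres_repr u : word_eq (repr (\pi_presented u)) u.
Proof. by apply: (proj2 (pres_piP _ _)); rewrite reprK. Qed.

Lemma pres_mul_pi u v :
  pres_mul (\pi_presented u) (\pi_presented v) = \pi_presented (u ++ v).
Proof. by apply: (proj1 (pres_piP _ _)); apply: word_eq_cat; apply: pres_repr. Qed.

Lemma pres_inv_pi u : pres_inv (\pi_presented u) = \pi_presented (word_inv u).
Proof. by apply: (proj1 (pres_piP _ _)); apply: word_eq_inv; apply: pres_repr. Qed.

Lemma pres_pi_surj (a : presented) : exists u, a = \pi_presented u.
Proof. by exists (repr a); rewrite reprK. Qed.

Lemma pres_mulA : associative pres_mul.
Proof.
move=> a b c; have [u ->] := pres_pi_surj a; have [v ->] := pres_pi_surj b.
by have [w ->] := pres_pi_surj c; rewrite !pres_mul_pi catA.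
Qed.

Lemma pres_mul1g : left_id pres_one pres_mul.
Proof. by move=> a; have [u ->] := pres_pi_surj a; rewrite pres_mul_pi. Qed.

Lemma pres_mulg1 : right_id pres_one pres_mul.
Proof.
by move=> a; have [u ->] := pres_pi_surj a; rewrite pres_mul_pi cats0.
Qed.

Lemma pres_mulVg : left_inverse pres_one pres_inv pres_mul.
Proof.
move=> a; have [u ->] := pres_pi_surj a; rewrite pres_inv_pi pres_mul_pi.
exact: (proj1 (pres_piP _ _) (word_eq_invl u)).
Qed.

Lemma pres_mulgV : right_inverse pres_one pres_inv pres_mul.
Proof.
move=> a; have [u ->] := pres_pi_surj a; rewrite pres_inv_pi pres_mul_pi.
exact: (proj1 (pres_piP _ _) (word_eq_invr u)).
Qed.

HB.instance Definition _ := isGroup.Build presented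
  pres_mulA pres_mul1g pres_mulg1 pres_mulVg pres_mulgV.

Definition pres_gen (x : X) : presented := \pi_presented [:: (x, true)].

End Presentation.

Definition subgroup (G : groupType) : set (set G) :=
  [set H | group_closed (mem H)].

Definition generated (G : groupType) (S : set G) : set G :=
  smallest (@subgroup G) S.

Definition conj_set (G : groupType) (g : G) (H : set G) : set G :=
  [set g * h * g^-1 | h in H].

(* Only the values of [label] on [edge] are relevant. *)
Record labeled_graph := LabeledGraph {
  vertex : finType;
  vertex_nonempty : 0 < #|vertex|;
  edge : {set {set vertex}};
  edge_card2 : forall e : {set vertex}, e \in edge -> #|e| = 2;
  label : {set vertex} -> nat;
  label_ge2 : forall e : {set vertex}, e \in edge -> 2 <= label e
}.

(* The word [v w v ...] with [n] letters. *)
Fixpoint alternating (X : Type) (n : nat) (v w : X) : word X :=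
  if n is n'.+1 then (v, true) :: alternating n' w v else [::].

Inductive artin_relation (Gamma : labeled_graph) :
    word (vertex Gamma) -> word (vertex Gamma) -> Prop :=
| ArtinRelation v w : [set v; w]%SET \in edge Gamma ->
    artin_relation (alternating (label [set v; w]%SET) v w)
                   (alternating (label [set v; w]%SET) w v).

Definition artin (Gamma : labeled_graph) : groupType :=
  presented (@artin_relation Gamma).

Definition artin_gen (Gamma : labeled_graph) (v : vertex Gamma) : artin Gamma :=
  pres_gen (@artin_relation Gamma) v.

Definition standard_parabolic (Gamma : labeled_graph)
    (X : {set vertex Gamma}) : set (artin Gamma) :=
  generated [set artin_gen v | v in [set` X]].

Definition parabolic (Gamma : labeled_graph) : set (set (artin Gamma)) :=
  [set P | exists (g : artin Gamma) (X : {set vertex Gamma}),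
    P = conj_set g (standard_parabolic X)].

Definition classA (Gamma : labeled_graph) : Prop :=
  forall P Q : set (artin Gamma),
    parabolic P -> parabolic Q -> parabolic (P `&` Q).

Definition minimal_parabolic_containing (Gamma : labeled_graph)
    (B P : set (artin Gamma)) : Prop :=
  [/\ parabolic P, B `<=` P &
    forall Q : set (artin Gamma),
      parabolic Q -> B `<=` Q -> Q `<=` P -> Q = P].

(* Main.v *)
Require Import Defs.
From mathcomp Require Import all_boot ssralg ssrnum countalg poly polydiv rat.
From mathcomp Require Import cyclic separable closed_field.
From mathcomp Require Import boolp classical_sets.

(** An arbitrary intersection reduces to a finite one as soon as every
    nonempty family of parabolic subgroups has a minimal member: a minimal
    parabolic subgroup Q above the intersection of the P i satisfies
    Q `&` P i = Q for every i, because Q `&` P i is again parabolic and above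
    the intersection.  There are only finitely many sets X of vertices, so
    minimal members exist once two nested conjugates of the same A_X are known
    to be equal ([same_type_sub_eq]), that is, once a A_X a^-1 cannot be a
    proper subgroup of A_X ([standard_parabolic_conj_sub]).

    This last fact is the substance of the proof, and it holds in every Artin
    group.  It rests on a retraction of the Artin group A onto A_X, which is
    not a homomorphism but a cocycle over the cosets of the parabolic subgroup
    W_X in the Coxeter group W.  Concretely, A acts on the right on A x C,
    where C is the set of elements r of W that are shortest in their coset
    W_X r.  A generator s sends (h, r) to (h, r s) when r s is again shortest;
    otherwise r s = x r for some x in X, and (h, r) goes to (h x, r).
    The action commutes with left multiplication by A, and a word in X
    sends (1, 1) to (its value, 1).

    Suppose now that a A_X a^-1 is contained in A_X and that a sends (1, 1) to
    (q, c); then q lies in A_X.  For x in X write a x = h' a with h' in A_X.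
    Both sides send (1, 1) to points with the same second component c, so x
    fixes c, which means c x = y c with y in X, and comparing first
    components gives q y = h' q, that is, a x a^-1 = q y q^-1.  The map
    sending x to y is conjugation by c in W; it is injective on the finite set
    X, hence onto X.  Therefore q A_X q^-1 = A_X is contained in a A_X a^-1.

    That the action respects the braid relation of an edge {s, t} with label
    m is the delicate point ([retract_braid]).  Follow the
    alternating walk of s and t on C, and record the elements of X that it
    emits.  Whenever the walk emits, it does not move, and so it retraces its
    steps backwards; hence the emitted elements alternate between two vertices
    x and y ([bouncing_hits]).  The walk has period 2 m because (s t)^m = 1 in
    W, and the two sides of the braid relation are the first half of a period
    and the second half read backwards.  Both halves emit the same number k of
    letters, so x y x ... = y x y ... with k letters has to hold in A.  In W
    one gets (x y)^k = 1, and the order of x y in W is exactly the label of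
    {x, y} ([coxeter_order]), so k is a multiple of this label and the
    identity follows from the braid relation of x and y. *)

Set Implicit Arguments.
Unset Strict Implicit.
Unset Printing Implicit Defensive.

(** * Alternating words *)
Section Zigzag.
Variable T : Type.
Implicit Types (x y : T) (n : nat).

Fixpoint zigzag n x y : seq T :=
  if n is n'.+1 then x :: zigzag n' y x else [::].

Lemma size_zigzag n x y : size (zigzag n x y) = n.
Proof. by elim: n x y => //= n IH x y; rewrite IH. Qed.

Lemma zigzagD m n x y :
  zigzag (m + n) x y =
  zigzag m x y ++ (if odd m then zigzag n y x else zigzag n x y).
Proof. by elim: m x y => //= m IH x y; rewrite IH; case: odd. Qed.

Lemma zigzagSr n x y :
  zigzag n.+1 x y = rcons (zigzag n x y) (if odd n then y else x).
Proof. by elim: n x y => //= n IH x y; rewrite if_neg -IH. Qed.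

Lemma rev_zigzag n x y :
  rev (zigzag n x y) = if odd n then zigzag n x y else zigzag n y x.
Proof.
elim: n x y => // n IH x y; rewrite [in LHS]zigzagSr rev_rcons IH /=.
by case: (odd n).
Qed.

End Zigzag.

Lemma alternatingE (T : Type) n (x y : T) :
  alternating n x y = [seq (z, true) | z <- zigzag n x y].
Proof. by elim: n x y => //= n IH x y; rewrite IH. Qed.

(** * Letter-by-letter actions of words *)
Section WordAction.
Variables (X : choiceType) (R : word X -> word X -> Prop).
Variables (Omega : Type) (f : X * bool -> Omega -> Omega).

Definition run (u : word X) (o : Omega) : Omega := foldl (fun o a => f a o) o u.

Lemma run_cat u v o : run (u ++ v) o = run v (run u o).
Proof. exact: foldl_cat. Qed.

Lemma run_inv (Inv : Omega -> Prop) :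
  (forall a o, Inv o -> Inv (f a o)) -> forall u o, Inv o -> Inv (run u o).
Proof. by move=> fI; elim=> //= a u IH o oI; apply/IH/fI. Qed.

(** The universal property of a presented group, in the form needed for right
    actions.  The invariant lets the action be well defined only on the points
    where the relators act trivially. *)
Lemma word_eq_run (Inv : Omega -> Prop) :
  (forall a o, Inv o -> Inv (f a o)) ->
  (forall x b o, Inv o -> f (x, ~~ b) (f (x, b) o) = o) ->
  (forall u v o, R u v -> Inv o -> run u o = run v o) ->
  forall u v, word_eq R u v -> forall o, Inv o -> run u o = run v o.
Proof.
move=> fI fK fR u v; elim=> {u v}.
- by [].
- by move=> u v _ IH o oI; rewrite IH.
- by move=> u v w _ IH _ IH' o oI; rewrite IH ?IH'.
- move=> u u' v v' _ IH _ IH' o oI; rewrite !run_cat IH // IH' //.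
  exact: run_inv.
- by move=> x b o oI; apply: fK.
- by move=> u v /fR.
Qed.

End WordAction.

(** * Roots of unity *)
Section PrimRoot.
Import GRing.Theory.
Local Open Scope ring_scope.

Lemma char0_closed_field :
  exists K : closedFieldType, forall n : nat, n != 0%N -> n%:R != 0 :> K.
Proof.
have [K [f _]] := countable_algebraic_closure (rat : countFieldType).
exists K => n n0; rewrite -(rmorph_nat f) fmorph_eq0.
by rewrite Num.Theory.pnatr_eq0.
Qed.

Lemma separable_XnsubC (K : fieldType) (n : nat) :
  n%:R != 0 :> K -> separable_poly ('X^n - 1 : {poly K}).
Proof.
case: n => [/eqP//|n nK]; rewrite unlock derivB derivC subr0 derivXn.
apply/Bezout_coprimepP; exists (-1, n.+1%:R^-1 *: 'X) => /=.
rewrite mulN1r opprB -scaler_nat -scalerAl -scalerAr scalerA mulVf // scale1r.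
by rewrite -exprS subrK eqpxx.
Qed.
Lemma ex_prim_root (K : closedFieldType) (n : nat) :
  n%:R != 0 :> K -> exists z : K, n.-primitive_root z.
Proof.
move=> nK; have n0 : (0 < n)%N by case: n nK => //; rewrite eqxx.
have [r] := closed_field_poly_normal ('X^n - 1 : {poly K}).
rewrite (monicP _) ?monicXnsubC // scale1r => XnE.
have uniq_r : uniq r by rewrite -separable_prod_XsubC -XnE separable_XnsubC.
have size_r : (n <= size r)%N.
  by rewrite -ltnS -(size_prod_XsubC r id) -XnE size_XnsubC.
have root_r : all n.-unity_root r.
  by apply/allP => z; rewrite -root_prod_XsubC -XnE.
by have /hasP[z _ pz] := has_prim_root n0 root_r uniq_r size_r; exists z.
Qed.

End PrimRoot.
(** * The numbers game *)

(** This is the contragredient geometric representation of a Coxeter group on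
    functions on the vertices, with 2 cos (pi / m) replaced by w + w^-1.  For
    an edge, w is a primitive root of unity of order 2 m; for a pair of
    vertices that is not an edge, any w of infinite order will do.  The
    purpose is to bound from below the orders of products of two generators,
    by an eigenvalue of the corresponding pair of moves. *)
Section NumbersGame.
Import GRing.Theory.
Local Open Scope ring_scope.
Variables (V : finType) (K : fieldType) (z : {set V} -> K).
Hypothesis z_neq0 : forall e, z e != 0.

Definition weight (x y : V) : K := z [set x; y]%SET + (z [set x; y]%SET)^-1.

Definition fire (a : V * bool) (f : V -> K) (v : V) : K :=
  if v == a.1 then - f v else f v + weight a.1 v * f a.1.

Lemma fireK x b b' f : fire (x, b') (fire (x, b) f) = f.
Proof.
apply/funext => v; rewrite /fire /= eqxx; case: eqVneq => _; first exact: opprK.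
by rewrite mulrN addrK.
Qed.

(** On the two coordinates s and t the alternating firing sequence has the
    characteristic roots r and r^-1, so a function is written there as a
    combination of the two eigenvectors, with coefficients a and b; each step
    multiplies a by r and b by r^-1 and exchanges the roles of s and t.  The
    other coordinates accumulate the fired values. *)
Lemma run_fire n (s t : V) (f : V -> K) (a b : K) :
  let r := z [set s; t]%SET in
  let F := run fire [seq (x, true) | x <- zigzag n s t] f in
  s != t -> f s = a + b -> f t = - (a * r^-1 + b * r) ->
  [/\ F (if odd n then t else s) = a * r ^+ n + b * r^-1 ^+ n,
      F (if odd n then s else t) =
        - (a * r ^+ n * r^-1 + b * r^-1 ^+ n * r)
    & forall v, v != s -> v != t ->
      F v = f v + \sum_(i < n) weight (if odd i then t else s) v *
                                (a * r ^+ i + b * r^-1 ^+ i)].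
Proof.
move=> r; have r0 : r != 0 by exact: z_neq0.
elim: n s t f a b @r r0 => [|n IH] s t f a b r r0 F st fs ft.
  rewrite /F /= !expr0 !mulr1; split=> // v _ _.
  by rewrite big_ord0 addr0.
have rE : z [set t; s]%SET = r by rewrite finset.setUC.
pose f' := fire (s, true) f.
have f't : f' t = a * r + b * r^-1.
  rewrite /f' /fire /= eq_sym (negPf st) ft fs /weight -/r mulrDl !mulrDr.
  rewrite ![r * _]mulrC ![_^-1 * _]mulrC [a * r + b * r]addrC addrACA.
  by rewrite [b * r + _]addrC addKr.
have f's : f' s = - (a * r * r^-1 + b * r^-1 * r).
  by rewrite /f' /fire /= eqxx fs -!mulrA divff // mulVf // !mulr1.
have := IH t s f' (a * r) (b * r^-1); rewrite rE eq_sym => /(_ r0 st f't f's).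
have -> : F = run fire [seq (x, true) | x <- zigzag n t s] f' by [].
rewrite -!(mulrA a) -!(mulrA b) -!exprS !mulrA /= !if_neg.
case=> -> -> IHv; split=> // v vs vt.
rewrite IHv // big_ord_recl /= !expr0 !mulr1 -fs.
rewrite addrA /f' {1}/fire /= (negPf vs); congr (_ + _).
by apply: eq_bigr => i _; rewrite if_neg -!mulrA -!exprS.
Qed.

Lemma sum_alternating (d : bool -> K) (w : K) k :
  \sum_(i < k.*2) d (odd i) * w ^+ i =
  (d false + d true * w) * \sum_(j < k) (w ^+ 2) ^+ j.
Proof.
elim: k => [|k IH]; first by rewrite !big_ord0 mulr0.
rewrite doubleS !big_ord_recr /= IH odd_double /= mulrDr -addrA; congr (_ + _).
by rewrite mulrDl -exprM mul2n -mulrA -exprS.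
Qed.

Lemma geometric_sum0 (w : K) k :
  w != 1 -> w ^+ k = 1 -> \sum_(j < k) w ^+ j = 0.
Proof.
move=> w1 wk; apply/eqP; have := subrX1 w k; rewrite wk subrr => /esym/eqP.
by rewrite mulf_eq0 subr_eq0 (negPf w1).
Qed.

(** After 2 k steps the coordinates at s and t are back to their initial
    values because r^(2k) = 1, and what the other coordinates have accumulated
    is a multiple of a full geometric sum in r^2 or r^-2, hence zero. *)
Lemma run_fire_braid k (s t : V) (f : V -> K) :
  let r := z [set s; t]%SET in
  s != t -> r ^+ 2 != 1 -> r ^+ k.*2 = 1 ->
  run fire [seq (x, true) | x <- zigzag k.*2 s t] f = f.
Proof.
move=> r st r2 rk; have r0 : r != 0 by exact: z_neq0.
have rV : r - r^-1 != 0.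
  by apply: contraNneq r2 => /subr0_eq e; rewrite expr2 {2}e divff.
have rVk : r^-1 ^+ k.*2 = 1 by rewrite exprVn rk invr1.
(* The solution of the system a + b = f s, a r^-1 + b r = - f t. *)
pose a := (f s * r + f t) / (r - r^-1); pose b := f s - a.
have fs : f s = a + b by rewrite addrC subrK.
have ft : f t = - (a * r^-1 + b * r).
  have E : a * (r - r^-1) = f s * r + f t by rewrite mulfVK.
  by rewrite mulrBl addrCA -mulrBr -[_ - r]opprB mulrN E opprB addrC addKr.
clearbody a b; have [] := @run_fire k.*2 s t f a b st fs ft.
rewrite -/r odd_double rk rVk !mulr1 -fs -ft => Fs Ft Fv.
apply/funext => v; have [->//|vs] := eqVneq v s; have [->//|vt] := eqVneq v t.
rewrite {}Fv //; apply/eqP; rewrite addrC -subr_eq0 addrK; apply/eqP.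
under eq_bigr => i _ do rewrite mulrDr !mulrA.
rewrite big_split /=.
have sum0 c w : w ^+ 2 != 1 -> w ^+ k.*2 = 1 ->
    \sum_(i < k.*2) weight (if odd i then t else s) v * c * w ^+ i = 0.
  move=> w2 wk; rewrite (sum_alternating (fun e => weight (if e then t else s) v * c)).
  by rewrite geometric_sum0 ?mulr0 // -exprM mul2n.
by rewrite !sum0 ?addr0 // ?exprVn ?invr_eq1 ?rk ?invr1.
Qed.

Lemma run_fire_order k (s t : V) :
  let r := z [set s; t]%SET in
  s != t ->
  (forall f, run fire [seq (x, true) | x <- zigzag k.*2 s t] f = f) ->
  r ^+ k.*2 = 1.
Proof.
(* This f is the pure eigenvector a = 1, b = 0. *)
move=> r st rk; pose f v := if v == s then 1 else - r^-1.
have [] := @run_fire k.*2 s t f 1 0 st.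
- by rewrite /f eqxx addr0.
- by rewrite /f eq_sym (negPf st) mul1r mul0r addr0.
by rewrite rk odd_double /f eqxx mul0r addr0 mul1r.
Qed.

End NumbersGame.

Local Open Scope group_scope.

(** * The Coxeter group *)

Lemma mulg_expgC (G : groupType) (a b : G) n :
  a * (b * a) ^+ n = (a * b) ^+ n * a.
Proof.
elim: n => [|n IH]; first by rewrite mul1g mulg1.
by rewrite expgSr mulgA IH expgSr !mulgA.
Qed.

Section Coxeter.
Variable Gamma : labeled_graph.
Local Notation V := (vertex Gamma).
Local Notation m x y := (label [set x; y]%SET).

(** For involutions x and y the braid relation with m letters is equivalent to
    (x y)^m = 1, the alternating word with 2 m letters; this form spares
    reversing words when a relation is checked. *)
Inductive coxeter_relation : word V -> word V -> Prop :=
| CoxeterSquare x : coxeter_relation [:: (x, true); (x, true)] [::]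
| CoxeterBraid x y : [set x; y]%SET \in edge Gamma ->
    coxeter_relation (alternating (m x y).*2 x y) [::].

Definition coxeter : groupType := presented coxeter_relation.

Local Notation W := coxeter.

Definition cox_word (u : word V) : W := \pi_(presented coxeter_relation)%qT u.
Definition cox_gen (x : V) : W := cox_word [:: (x, true)].

Local Notation g := cox_gen.
Local Notation pi := cox_word.

Lemma cox_wordM u v : pi (u ++ v) = pi u * pi v :> W.
Proof. exact/esym/pres_mul_pi. Qed.

Lemma cox_genK x : g x * g x = 1 :> W.
Proof.
rewrite -cox_wordM; apply: (proj1 (pres_piP _ _ _)).
exact/word_eq_rel/CoxeterSquare.
Qed.

Lemma cox_genV x : (g x)^-1 = g x.
Proof. exact/mulg1_eq/cox_genK. Qed.

Lemma cox_word1 x b : pi [:: (x, b)] = g x :> W.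
Proof.
case: b => //; rewrite -[RHS]cox_genV; apply/esym/mulg1_eq.
rewrite -cox_wordM; apply: (proj1 (pres_piP _ _ _)); exact: word_eq_cancel.
Qed.

Definition cox_prod (l : seq V) : W := pi [seq (x, true) | x <- l].

Lemma cox_prod_nil : cox_prod [::] = 1. Proof. by []. Qed.

Lemma cox_prod_cat k l : cox_prod (k ++ l) = cox_prod k * cox_prod l.
Proof. by rewrite /cox_prod map_cat cox_wordM. Qed.

Lemma cox_prod_cons x l : cox_prod (x :: l) = g x * cox_prod l.
Proof. exact: (cox_prod_cat [:: x]). Qed.

Lemma cox_prod_rev l : cox_prod (rev l) = (cox_prod l)^-1.
Proof.
elim: l => [|x l IH]; first by rewrite invg1.
rewrite rev_cons -cats1 cox_prod_cat IH !cox_prod_cons cox_prod_nil mulg1.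
by rewrite invgM cox_genV.
Qed.

Lemma cox_prod_zigzag k x y : cox_prod (zigzag k.*2 x y) = (g x * g y) ^+ k.
Proof.
elim: k => // k IH; rewrite doubleS /= !cox_prod_cons IH expgS !mulgA //.
Qed.

Lemma cox_braid x y : [set x; y]%SET \in edge Gamma -> (g x * g y) ^+ m x y = 1.
Proof.
move=> xy; rewrite -cox_prod_zigzag /cox_prod -alternatingE.
apply: (proj1 (pres_piP _ _ _)); exact/word_eq_rel/CoxeterBraid.
Qed.

(** The reflection in the j-th wall crossed by an alternating gallery: seen
    from the start of the gallery, these walls are the (x y)^j x. *)
Lemma cox_prod_zigzag_refl x y j :
  cox_prod (zigzag j x y) * g (if odd j then y else x) * (cox_prod (zigzag j x y))^-1 =
  (g x * g y) ^+ j * g x.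
Proof.
elim: j x y => [|j IH] x y /=; first by rewrite invg1 mulg1 mul1g.
rewrite cox_prod_cons invgM cox_genV !mulgA -(mulgA (g x)) -(mulgA (g x) (_ * _)).
have -> : (if ~~ odd j then y else x) = if odd j then x else y by case: odd.
by rewrite IH mulgA mulg_expgC expgSr !mulgA.
Qed.

Lemma edge_neq x y : [set x; y]%SET \in edge Gamma -> x != y.
Proof.
by move=> /edge_card2; rewrite cards2; case: eqP.
Qed.

(** The order of x y is exactly the label of the edge {x, y}, and it is
    infinite if there is no edge: the numbers game has an eigenvalue of that
    order.  Without an edge the eigenvalue is 2, which has infinite order in
    characteristic zero. *)
Lemma coxeter_order x y k :
  x != y -> (g x * g y) ^+ k = 1 -> (0 < k)%N ->
  [set x; y]%SET \in edge Gamma /\ (m x y %| k)%N.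
Proof.
move=> xy xyk k0; have [K char0] := char0_closed_field.
pose good (e : {set V}) (w : K) : Prop :=
  if e \in edge Gamma then is_true ((label e).*2.-primitive_root w)%R
  else w = (2%:R)%R.
have /choice[z zP] : forall e, exists w, good e w.
  rewrite /good => e; case eE: (e \in edge Gamma); last by exists (2%:R)%R.
  have /char0/ex_prim_root[w pw] : ((label e).*2 != 0)%N.
    by rewrite double_eq0 -lt0n (ltnW (label_ge2 eE)).
  by exists w.
have z0 e : (z e != 0)%R.
  have := zP e; rewrite /good; case: ifP => _; last by move=> ->; apply: char0.
  move=> pz; apply/eqP => z0; have := prim_expr_order pz; rewrite z0.
  by move/eqP; rewrite GRing.expr0n gtn_eqF ?(prim_order_gt0 pz) // eq_sym GRing.oner_eq0.
have runE u v : word_eq coxeter_relation u v ->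
    forall f, run (fire z) u f = run (fire z) v f.
  move=> uv f; apply: (@word_eq_run _ _ _ (fire z) (fun=> True) _ _ _ _ _ uv) => //.
    by move=> a b h _; apply: fireK.
  move=> u' v' h [a|a b abE] _; first exact: fireK.
  have := zP [set a; b]%SET; rewrite /good abE => pz.
  rewrite alternatingE run_fire_braid ?edge_neq //.
    rewrite -(prim_order_dvd pz) -[2]/(1.*2) -!mul2n dvdn_pmul2l // dvdn1.
    by rewrite gtn_eqF // (label_ge2 abE).
  exact: prim_expr_order pz.
have zk : (z [set x; y]%SET ^+ k.*2 = 1)%R.
  apply: run_fire_order => // f; rewrite (runE _ [::]) //.
  by apply/(pres_piP coxeter_relation); rewrite -[LHS]/(cox_prod _) cox_prod_zigzag.
have := zP [set x; y]%SET; rewrite /good; case: ifP => [xyE pz|_ z2].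
  split=> //; move/eqP: zk; rewrite -(prim_order_dvd pz) -!mul2n dvdn_pmul2l //.
move: zk; rewrite z2 -GRing.natrX => /eqP; rewrite -GRing.subr_eq0.
rewrite -[X in (_ - X)%R]GRing.mulr1n -GRing.natrB ?expn_gt0 //.
rewrite (negPf (char0 _ _)) // subn_eq0 -ltnNge.
by rewrite -{1}(expn0 2) ltn_exp2l // double_gt0.
Qed.

End Coxeter.

(** * Walls separating chambers *)
Section Sign.
Variable Gamma : labeled_graph.
Local Notation V := (vertex Gamma).
Local Notation W := (coxeter Gamma).
Local Notation g := (@cox_gen Gamma).
Local Notation pi := (@cox_word Gamma).
Local Notation m x y := (label [set x; y]%SET).

(** The action of a generator on signed reflections.  The conjugating element
    is an arbitrary element of W, which avoids a type of reflections. *)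
Definition sign_step (a : V * bool) (o : W * bool) : W * bool :=
  (g a.1 * o.1 * g a.1, o.2 (+) (o.1 == g a.1)).

Lemma sign_stepK x b b' o : sign_step (x, b') (sign_step (x, b) o) = o.
Proof.
case: o => t e; rewrite /sign_step /= !mulgA cox_genK mul1g -mulgA cox_genK mulg1.
congr pair; rewrite -[X in _ (+) (_ == X)]mul1g -(cox_genK x).
by rewrite (inj_eq (mulIg _)) (inj_eq (mulgI _)) -addbA addbb addbF.
Qed.

Lemma run_sign u t e :
  run sign_step u (t, e) =
  ((pi u)^-1 * t * pi u, e (+) (run sign_step u (t, false)).2).
Proof.
elim: u t e => [|[x b] u IH] t e.
  by rewrite /= addbF invg1 mul1g mulg1.
rewrite -cat1s cox_wordM cox_word1 /= {1}/sign_step /= IH (IH _ (_ == _)) /=.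
by rewrite addbA invgM cox_genV !mulgA.
Qed.

Lemma run_sign_zigzag n x y t :
  (run sign_step [seq (z, true) | z <- zigzag n x y] (t, false)).2 =
  \big[addb/false]_(j < n) (t == (g x * g y) ^+ j * g x).
Proof.
elim: n x y t => [|n IH] x y t; first by rewrite big_ord0.
rewrite /= {1}/sign_step /= run_sign /= IH big_ord_recl /= mul1g; congr (_ (+) _).
apply: eq_bigr => i _; rewrite /bump /= add1n -(mulg_expgC (g x)) expgSr.
rewrite -[RHS](inj_eq (mulgI (g x))) -[RHS](inj_eq (mulIg (g x))) !mulgA.
by rewrite cox_genK mul1g -(mulgA _ (g x) (g x)) cox_genK mulg1.
Qed.

(** The gallery of (x y)^m crosses each of its walls twice, the walls (x y)^j x
    for j < m being repeated for m <= j < 2 m; so all signs are restored. *)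
Lemma word_eq_sign u v : word_eq (@coxeter_relation Gamma) u v ->
  run sign_step u =1 run sign_step v.
Proof.
move=> uv o.
apply: (@word_eq_run _ _ _ sign_step (fun=> True) _ _ _ _ _ uv) => //.
  by move=> x b h _; apply: sign_stepK.
move=> u' v' [t e] [x|x y xyE] _; first exact: sign_stepK.
rewrite alternatingE run_sign run_sign_zigzag -/(cox_prod _) cox_prod_zigzag cox_braid //.
rewrite invg1 mul1g mulg1 /=; congr pair.
rewrite -addnn big_split_ord /=.
under [X in _ (+) (_ (+) X)]eq_bigr => j _ do
  rewrite expgnDr cox_braid // mul1g.
by rewrite addbb addbF.
Qed.

(** For a reflection t, [sign w t] tells whether the wall of t separates the
    chambers 1 and w, equivalently whether t w is shorter than w. *)
Definition sign (w t : W) : bool := (run sign_step (repr w) (t, false)).2.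

Lemma sign_word u t : sign (pi u) t = (run sign_step u (t, false)).2.
Proof. by rewrite /sign (word_eq_sign (pres_repr _ u)). Qed.

Lemma signM u v t : sign (u * v) t = sign u t (+) sign v (u^-1 * t * u).
Proof.
have [u' ->] := pres_pi_surj u; have [v' ->] := pres_pi_surj v.
by rewrite -cox_wordM !sign_word run_cat (run_sign u') [in LHS](run_sign v').
Qed.

Lemma sign1 t : sign 1 t = false.
Proof. by rewrite (sign_word [::]). Qed.

Lemma sign_gen x t : sign (g x) t = (t == g x).
Proof. by rewrite (sign_word [:: (x, true)]). Qed.

Lemma cox_gen_neq1 x : g x != 1.
Proof. by apply: contraTneq (eqxx (g x)) => e; rewrite -sign_gen {1}e sign1. Qed.

Lemma cox_gen_inj : injective g.
Proof.
move=> x y e; apply/eqP/negPn/negP => xy.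
have xy1 : (g x * g y) ^+ 1 = 1 by rewrite expg1 e cox_genK.
have [xyE] := coxeter_order xy xy1 isT.
by rewrite dvdn1 gtn_eqF // (label_ge2 xyE).
Qed.

(** If t separates 1 from w, then every gallery from 1 to w crosses the wall
    of t, and crossing it at the letter x after the prefix k means that
    t k = k x. *)
Lemma sign_cox_prod l t : sign (cox_prod l) t ->
  exists k x k', l = k ++ x :: k' /\ t * cox_prod k = cox_prod k * g x.
Proof.
elim: l t => [|x l IH] t; first by rewrite sign1.
rewrite cox_prod_cons signM sign_gen.
have [-> _|_ /= /IH[k [y [k' [-> E]]]]] := eqVneq t (g x).
  by exists [::], x, l; rewrite mulg1 mul1g.
exists (x :: k), y, k'; split=> //; rewrite cox_prod_cons -[RHS]mulgA -E.
by rewrite !mulgA mulgV mul1g.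
Qed.

(** ** Shortest representatives of the cosets of W_X *)
Section Parabolic.
Variable X : {set V}.

Definition in_std (w : W) := exists2 l, all (mem X) l & w = cox_prod l.

Lemma in_std1 : in_std 1. Proof. by exists [::]. Qed.
Lemma in_std_gen x : x \in X -> in_std (g x).
Proof. by move=> xX; exists [:: x]; rewrite //= xX. Qed.
Lemma in_stdM u v : in_std u -> in_std v -> in_std (u * v).
Proof.
by move=> [k kX ->] [l lX ->]; exists (k ++ l); rewrite ?cox_prod_cat // all_cat kX.
Qed.
Lemma in_stdV u : in_std u -> in_std u^-1.
Proof. by move=> [k kX ->]; exists (rev k); rewrite ?cox_prod_rev // all_rev. Qed.

(** An element of W_X without descent in X is trivial.  If its word starts
    with x and x is not a descent, then the wall of x is crossed a second
    time, and deleting the two letters that cross it gives a shorter word. *)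
Lemma in_std_sign_eq1 w : in_std w -> (forall x, x \in X -> sign w (g x) = false) ->
  w = 1.
Proof.
case=> l; elim: {l}(size l).+1 {-2}l (ltnSn (size l)) w => // n IH.
case=> [|x l] ln w lX -> sX //.
have [xX {}lX] : x \in X /\ all (mem X) l by apply/andP.
have := sX x xX; rewrite cox_prod_cons signM sign_gen eqxx /= cox_genV cox_genK mul1g.
move=> /negbFE /sign_cox_prod[k [y [k' [lE kE]]]].
have E : g x * cox_prod l = cox_prod (k ++ k').
  rewrite lE !cox_prod_cat cox_prod_cons !mulgA kE.
  by rewrite -(mulgA (cox_prod k)) cox_genK mulg1.
rewrite E; apply: (IH (k ++ k')) => //.
- by move: ln; rewrite lE /= !size_cat /= addnS ltnS => /ltnW.
- by move: lX; rewrite lE !all_cat /= => /andP[-> /andP[_ ->]].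
- by move=> z /sX; rewrite cox_prod_cons E.
Qed.

Definition std_refl (t : W) :=
  exists2 w, in_std w & exists2 x, x \in X & t = w * g x * w^-1.

Lemma std_refl_gen x : x \in X -> std_refl (g x).
Proof.
move=> xX; exists 1; first exact: in_std1.
by exists x; rewrite // invg1 mulg1 mul1g.
Qed.

Lemma std_refl_conj t w : std_refl t -> in_std w -> std_refl (w * t * w^-1).
Proof.
move=> [u uX [x xX ->]] wX; exists (w * u); first exact: in_stdM.
by exists x => //; rewrite invgM !mulgA.
Qed.

Lemma std_refl_in t : std_refl t -> in_std t.
Proof.
by move=> [w wX [x /in_std_gen xX ->]]; apply/in_stdM/in_stdV => //; apply: in_stdM.
Qed.

Lemma std_refl_neq1 t : std_refl t -> t != 1.
Proof.
move=> [w _ [x _ ->]]; apply: contraNneq (cox_gen_neq1 x) => e.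
by rewrite -(inj_eq (mulgI w)) -(inj_eq (mulIg w^-1)) e mulg1 mulgV.
Qed.

(** No wall of W_X separates r from 1: these are the shortest elements of the
    cosets W_X r.  Asking it for all reflections of W_X instead of
    only those in X makes the condition stable under [turn]. *)
Definition reduced (r : W) := forall t, std_refl t -> sign r t = false.

Lemma reduced1 : reduced 1. Proof. by move=> t _; rewrite sign1. Qed.

(** If t = r s r^-1 is a reflection of W_X, then t is a simple reflection.  Some
    x in X is a descent of t, so the wall of x separates t r = r s from 1; it
    does not separate r from 1, hence it is the wall between r and r s, which
    is the wall of t. *)
Lemma reduced_wall r s : reduced r -> std_refl (r * g s * r^-1) ->
  exists2 x, x \in X & r * g s * r^-1 = g x.
Proof.
set t := _ * _ => rC tX; have tr : t * r = r * g s by rewrite mulgVK.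
have [x xX sx] : exists2 x, x \in X & sign t (g x).
  apply: contrapT => no; have /eqP := std_refl_neq1 tX; apply.
  apply: in_std_sign_eq1 (std_refl_in tX) _ => x xX.
  by apply/negP => sx; apply: no; exists x.
exists x => //; have := congr1 (sign^~ (g x)) tr.
rewrite /= (signM t) (signM r) sx (rC (g x)) ?sign_gen; last exact: std_refl_gen.
rewrite (rC (_ * _ * _)); last first.
  rewrite -[X in _ * X]invgK; apply: std_refl_conj; first exact: std_refl_gen.
  exact/in_stdV/std_refl_in.
by move=> /esym/eqP E; rewrite /t -E !mulgA mulgV mul1g mulgK.
Qed.

Lemma reduced_unique r r' w :
  reduced r -> reduced r' -> in_std w -> r' = w * r -> w = 1.
Proof.
move=> rC r'C wX E; apply: in_std_sign_eq1 => // x xX.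
have := r'C _ (std_refl_gen xX); rewrite E signM (rC (_ * _ * _)) ?addbF //.
rewrite -[X in _ * X]invgK; apply: std_refl_conj; first exact: std_refl_gen.
exact: in_stdV.
Qed.

End Parabolic.
End Sign.

(** * Sequences that bounce *)

Lemma pmap_iotaSr T (e : nat -> option T) i n :
  pmap e (iota i n.+1) = pmap e (iota i n) ++ seq_of_opt (e (i + n)%N).
Proof. by rewrite -addn1 iotaD pmap_cat /=; case: (e _). Qed.

(** Here [e] lists what a walk emits at each time, and the hypothesis says that
    the past is the mirror image of the future around each emission.  Then
    emissions are equally spaced, and each one equals the last but one. *)
Section Bouncing.
Variables (T : Type) (e : nat -> option T).
Hypothesis bounce :
  forall i j, e j -> (i <= j)%N -> e (j + i)%N = e (j - i)%N.

Let hits n := pmap e (iota 0 n).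

Let free i j := forall k, (i < k < j)%N -> e k = None.

Let freeS i n : free i n -> e n = None -> free i n.+1.
Proof.
move=> fr en k /andP[ik]; rewrite ltnS leq_eqVlt => /predU1P[->//|kn].
by apply: fr; rewrite ik.
Qed.

(** The induction keeps the times i < j of the last two emissions.  An emission
    at n is reflected by j to the time 2 j - n, and the emission at i to
    2 j - i; as nothing is emitted between i and j or between j and n,
    these force n - j = j - i. *)
Lemma bouncing_hits_aux n :
  [\/ hits n = [::],
      exists j x, [/\ (j < n)%N, e j = Some x, free j n & hits n = [:: x]]
    | exists i j x y k,
        [/\ [/\ (i < j)%N, (j < n)%N, free i j & free j n],
            e i = Some y, e j = Some x & rev (hits n) = zigzag k.+2 x y]].
Proof.
elim: n => [|n IH]; first by constructor 1.
rewrite /hits pmap_iotaSr add0n -/(hits n); case en: (e n) => [z|] /=; last first.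
  rewrite cats0; case: IH => [->|[j [x [jn ej fr ->]]]|].
  - by constructor 1.
  - by constructor 2; exists j, x; split=> //; [exact: ltnW|exact: freeS].
  move=> [i [j [x [y [k [[ij jn fij fjn] ei ej ->]]]]]].
  constructor 3; exists i, j, x, y, k; split=> //.
  by split=> //; [exact: ltnW|exact: freeS].
have freenn : free n n.+1.
  by move=> k /andP[nk]; rewrite ltnS leqNgt nk.
case: IH => [->|[j [x [jn ej fr ->]]]|].
- by constructor 2; exists n, z; split.
- by constructor 3; exists j, n, z, x, 0; split.
move=> [i [j [x [y [k [[ij jn fij fjn] ei ej hE]]]]]].
constructor 3; exists j, n, z, x, k.+1; split=> //; rewrite rev_cat hE /=.
have jE : e j by rewrite ej.
have nE : n = (j + (n - j))%N by rewrite subnKC // ltnW.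
have iE : i = (j - (j - i))%N by rewrite subKn // ltnW.
suff nij : (n - j = j - i)%N.
  suff -> : z = y by [].
  by apply: Some_inj; rewrite -en -ei nE nij bounce ?leq_subr // -iE.
apply/eqP; rewrite eqn_leq; apply/andP; split; rewrite leqNgt; apply/negP => lt.
  have : e (j + (j - i))%N = None.
    apply: fjn; rewrite -{1}[j]addn0 ltn_add2l subn_gt0 ij /=.
    by rewrite [X in (_ < X)%N]nE ltn_add2l.
  by rewrite bounce ?leq_subr // -iE ei.
have nj : (n - j <= j)%N by apply: ltnW (leq_trans lt (leq_subr _ _)).
have : e (j - (n - j))%N = None.
  apply: fij; rewrite {1}iE ltn_sub2l ?(leq_trans lt) ?leq_subr //=; last first.
  by rewrite ltn_subrL subn_gt0 jn (leq_ltn_trans _ ij).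
by rewrite -bounce // -nE en.
Qed.

Lemma bouncing_hits (x0 : T) n :
  exists x y, hits n = zigzag (size (hits n)) x y.
Proof.
case: (bouncing_hits_aux n) => [->|[j [x [_ _ _ ->]]]|].
- by exists x0, x0.
- by exists x, x.
move=> [i [j [x [y [k [_ _ _ hE]]]]]].
rewrite -[hits n]revK hE size_rev size_zigzag rev_zigzag.
by case: odd; [exists x, y|exists y, x].
Qed.

End Bouncing.

(** * The retraction onto a standard parabolic subgroup *)
Section Retraction.
Variables (Gamma : labeled_graph) (X : {set vertex Gamma}).
Local Notation V := (vertex Gamma).
Local Notation W := (coxeter Gamma).
Local Notation g := (@cox_gen Gamma).
Local Notation m x y := (label [set x; y]%SET).
Local Notation A := (artin Gamma).

Definition artin_word (u : word V) : A :=
  \pi_(presented (@artin_relation Gamma))%qT u.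

Lemma artin_wordM u v : artin_word (u ++ v) = artin_word u * artin_word v.
Proof. exact/esym/pres_mul_pi. Qed.

Lemma artin_word_cancel x b :
  artin_word [:: (x, b)] * artin_word [:: (x, ~~ b)] = 1.
Proof.
rewrite -artin_wordM; apply: (proj1 (pres_piP _ _ _)); exact: word_eq_cancel.
Qed.

Definition positive_word (l : seq V) : A := artin_word [seq (x, true) | x <- l].

Lemma positive_word_cat k l : positive_word (k ++ l) = positive_word k * positive_word l.
Proof. by rewrite /positive_word map_cat artin_wordM. Qed.

Lemma positive_braid x y : [set x; y]%SET \in edge Gamma ->
  positive_word (zigzag (m x y) x y) = positive_word (zigzag (m x y) y x).
Proof.
move=> xy; rewrite /positive_word -!alternatingE.
by apply: (proj1 (pres_piP _ _ _)); apply/word_eq_rel/ArtinRelation.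
Qed.

(** Each block of m letters is the same element Delta for the two orders of x
    and y, so alternating words with a multiple of m letters agree as well. *)
Lemma positive_braid_dvd k x y : [set x; y]%SET \in edge Gamma ->
  (m x y %| k)%N -> positive_word (zigzag k x y) = positive_word (zigzag k y x).
Proof.
move=> xy /dvdnP[q ->].
elim: q => [|q IH]; first by rewrite mul0n.
rewrite mulSn !zigzagD !positive_word_cat positive_braid //.
by case: odd; rewrite IH.
Qed.

(** The vertex x of X with x r = r s, if any: for reduced r, the step from r to
    r s then leaves the shortest elements by crossing the wall of x. *)
Definition wall (r : W) (s : V) : option V :=
  [pick x in X | g x == r * g s * r^-1].

Definition turn (r : W) (s : V) : W := if wall r s is Some _ then r else r * g s.

(** The second component follows the shortest representatives of the cosets of
    W_X, and the first one collects the generators of A_X, with the sign of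
    the letter read, each time the walk is stopped by a wall. *)
Definition retract (a : V * bool) (o : A * W) : A * W :=
  (o.1 * (if wall o.2 a.1 is Some x then artin_word [:: (x, a.2)] else 1),
   turn o.2 a.1).

Lemma retractE x b h r : retract (x, b) (h, r) =
  (h * (if wall r x is Some y then artin_word [:: (y, b)] else 1), turn r x).
Proof. by []. Qed.

Lemma wall_turn r s : wall (turn r s) s = wall r s.
Proof.
rewrite /turn; case E: (wall r s) => [x|] //; rewrite -E.
apply: eq_pick => x; rewrite invgM cox_genV.
by rewrite /= !mulgA -(mulgA r) cox_genK mulg1.
Qed.

Lemma turnK r s : turn (turn r s) s = r.
Proof.
rewrite {1}/turn wall_turn /turn; case: (wall r s) => // .
by rewrite -mulgA cox_genK mulg1.
Qed.

Lemma wall_std_refl r s : reduced X r ->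
  (wall r s : bool) <-> std_refl X (r * g s * r^-1).
Proof.
move=> rC; rewrite /wall; split.
  by case: pickP => // x /andP[xX /eqP <-] _; apply: std_refl_gen.
case/(reduced_wall rC) => x xX E; case: pickP => // /(_ x).
by rewrite /= xX E eqxx.
Qed.

Lemma reduced_turn r s : reduced X r -> reduced X (turn r s).
Proof.
move=> rC; rewrite /turn; case E: (wall r s) => [//|] t tX.
rewrite signM rC // sign_gen; apply/negP => /= /eqP ts.
suff : (wall r s : bool) by rewrite E.
by apply/wall_std_refl => //; rewrite -ts !mulgA mulgV mul1g mulgK.
Qed.

Lemma retractK x b o : retract (x, ~~ b) (retract (x, b) o) = o.
Proof.
case: o => h r; rewrite /retract /= wall_turn turnK; congr pair.
case: (wall r x) => [y|]; last by rewrite !mulg1.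
by rewrite -mulgA artin_word_cancel mulg1.
Qed.

(** ** Alternating walks and the braid relation *)
Section Walk.
Variables (r : W) (s t : V).
Hypothesis r_red : reduced X r.

Let letter i := if odd i then t else s.

Fixpoint walk i : W := if i is i'.+1 then turn (walk i') (letter i') else r.

Definition hit i : option V := wall (walk i) (letter i).

Let walk_reduced i : reduced X (walk i).
Proof. by elim: i => //= i; apply: reduced_turn. Qed.

Lemma run_walk n h :
  run retract [seq (x, true) | x <- zigzag n s t] (h, r) =
  (h * positive_word (pmap hit (iota 0 n)), walk n).
Proof.
elim: n => [|n IH]; first by rewrite /= mulg1.
rewrite zigzagSr -cats1 map_cat run_cat IH pmap_iotaSr add0n positive_word_cat mulgA.
by rewrite /= retractE -/(hit n); case: (hit n).
Qed.

(** Steps are involutions on the second component, so reading letters in the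
    reverse order retraces the walk and emits the same generators. *)
Lemma run_walk_back i n h :
  run retract [seq (x, true) | x <- zigzag n (letter (i + n).+1) (letter (i + n))]
    (h, walk (i + n)) =
  (h * positive_word (rev (pmap hit (iota i n))), walk i).
Proof.
elim: n h => [|n IH] h; first by rewrite /= addn0 mulg1.
have -> : letter (i + n.+1).+1 = letter (i + n).
  by rewrite /letter addnS /= negbK.
rewrite pmap_iotaSr rev_cat positive_word_cat mulgA addnS.
rewrite [zigzag n.+1 _ _]/= [walk _.+1]/= map_cons [run _ _ _]/=.
rewrite retractE turnK wall_turn -/(hit (i + n)) IH.
by case: (hit (i + n)).
Qed.

(** In W the emitted generators measure the difference between the walk and
    the gallery of all letters read. *)
Lemma walk_cox_prod n :
  r * cox_prod (zigzag n s t) = cox_prod (pmap hit (iota 0 n)) * walk n.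
Proof.
elim: n => [|n IH]; first by rewrite mulg1 mul1g.
rewrite zigzagSr -cats1 pmap_iotaSr add0n !cox_prod_cat mulgA IH /= -!mulgA.
congr (_ * _); rewrite /hit /turn cox_prod_cons mulg1 -/(letter n) /wall.
case: pickP => [x /andP[_ /eqP E]|_] /=; last by rewrite mul1g.
by rewrite cox_prod_cons mulg1 E mulgVK.
Qed.

Lemma hits_in_std n : in_std X (cox_prod (pmap hit (iota 0 n))).
Proof.
exists (pmap hit (iota 0 n)) => //; elim: (iota 0 n) => //= i l IH.
by rewrite /hit /wall; case: pickP => //= x /andP[-> _].
Qed.

(** At an emission the walk stays put, and the next letters are the previous
    ones in reverse order. *)
Lemma hit_bounce i j : hit j -> (i <= j)%N -> hit (j + i) = hit (j - i).
Proof.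
move=> hj ij.
have step k : (k <= j)%N -> walk (j + k).+1 = walk (j - k).
  elim: k => [|k IH] kj.
    by rewrite addn0 subn0 /= /turn; move: hj; rewrite /hit; case: wall.
  have kj' : (k <= j)%N by apply: ltnW.
  rewrite addnS [LHS]/= -/(walk (j + k).+1) IH // -[(j - k)%N]prednK ?subn_gt0 //.
  rewrite -subnS /= -[RHS](turnK _ (letter (j - k.+1))); congr (turn _ _).
  rewrite /letter; congr (if _ then _ else _).
  by rewrite /= oddD oddB //= addbN.
case: i ij => [|i] ij; first by rewrite addn0 subn0.
rewrite /hit addnS step; last exact: ltnW.
rewrite -[(j - i)%N]prednK ?subn_gt0 // -subnS [walk _.+1]/= -[RHS]wall_turn.
congr (wall (turn _ _) _); rewrite /letter; congr (if _ then _ else _).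
by rewrite /= oddD oddB //= addbN.
Qed.

(** Emission at time j only depends on the j-th wall of the gallery issued from
    r, not on the emissions so far: the walk differs from the gallery by an
    element of W_X, which permutes the reflections of W_X. *)
Lemma hit_std_refl j :
  (hit j : bool) <-> std_refl X (r * ((g s * g t) ^+ j * g s) * r^-1).
Proof.
rewrite /hit wall_std_refl // -cox_prod_zigzag_refl -/(letter j).
set w := cox_prod (pmap hit (iota 0 j)); have wX : in_std X w by apply: hits_in_std.
have -> : walk j = w^-1 * (r * cox_prod (zigzag j s t)) by rewrite walk_cox_prod mulKg.
set u := cox_prod (zigzag _ _ _).
have -> : r * (u * g (letter j) * u^-1) * r^-1 =
  w * (w^-1 * (r * u) * g (letter j) * (w^-1 * (r * u))^-1) * w^-1.
  by rewrite !invgM invgK !mulgA mulgV mul1g mulgK.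
split=> [/std_refl_conj/(_ wX)//|/std_refl_conj/(_ (in_stdV wX))].
by rewrite invgK !mulgA mulVg mul1g mulgVK.
Qed.

Hypothesis st : [set s; t]%SET \in edge Gamma.
Local Notation n := (m s t).

(** After a full turn the gallery is back at r, so the walk ends in the coset
    W_X r; as it stays among the shortest representatives, it ends at r. *)
Lemma walk_period : cox_prod (pmap hit (iota 0 (n + n))) = 1 /\ walk (n + n) = r.
Proof.
have E := walk_cox_prod (n + n); rewrite addnn cox_prod_zigzag cox_braid // mulg1 in E.
rewrite addnn; have := reduced_unique (walk_reduced _) r_red (hits_in_std _) E.
by move=> w1; split=> //; rewrite w1 mul1g in E.
Qed.

(** The two halves of a period meet the same walls, hence emit equally many
    letters k; together they form an alternating word with 2 k letters that is
    trivial in W, which makes k a multiple of the order of x y. *)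
Lemma positive_hits :
  positive_word (pmap hit (iota 0 n)) = positive_word (rev (pmap hit (iota n n))).
Proof.
have [ev1 _] := walk_period.
have [x [y]] := bouncing_hits hit_bounce s (n + n).
rewrite iotaD pmap_cat add0n in ev1 *; rewrite size_cat.
set P1 := pmap hit (iota 0 n) in ev1 *; set P2 := pmap hit (iota n n) in ev1 *.
have sP : size P2 = size P1.
  rewrite !size_pmap -[X in iota X _]addn0 iotaDl count_map; apply: eq_count => j /=.
  apply/idP/idP => /hit_std_refl H; apply/hit_std_refl; move: H.
    by rewrite expgnDr cox_braid // mul1g.
  by rewrite expgnDr cox_braid // mul1g.
rewrite sP; set k := size P1 => E.
have ek : (g x * g y) ^+ k = 1 by rewrite -cox_prod_zigzag -addnn -E.
have /andP[/eqP P1E /eqP P2E] : (P1 == zigzag k x y) &&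
    (P2 == if odd k then zigzag k y x else zigzag k x y).
  by rewrite -eqseq_cat ?size_zigzag // E zigzagD.
have -> : rev P2 = zigzag k y x.
  by rewrite P2E; case: ifP => ko; rewrite rev_zigzag ko.
rewrite P1E; have [->//|xy] := eqVneq x y.
have [->//|k0] := posnP k.
have [xyE kd] := coxeter_order xy ek k0.
exact: positive_braid_dvd.
Qed.

(** Going t, s, t, ... from r is going backwards from the end of the period. *)
Lemma retract_braid h :
  run retract (alternating n s t) (h, r) = run retract (alternating n t s) (h, r).
Proof.
rewrite !alternatingE run_walk positive_hits.
have := run_walk_back n n h; have [_ ->] := walk_period.
by rewrite /letter /= addnn odd_double /= => ->.
Qed.

End Walk.

Lemma word_eq_retract u v : word_eq (@artin_relation Gamma) u v ->
  forall o, reduced X o.2 -> run retract u o = run retract v o.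
Proof.
apply: word_eq_run => [a o|x b o _|u' v' [h r] [s t st] /= rC].
- exact: reduced_turn.
- exact: retractK.
- exact: retract_braid.
Qed.

End Retraction.

Local Open Scope classical_set_scope.

(** * Subgroups and their conjugates *)

Section Subgroups.
Variable G : groupType.
Implicit Types (H K : set G) (g h : G).

Lemma subgroupP H :
  subgroup H <-> H 1 /\ forall u v, H u -> H v -> H (u * v^-1).
Proof.
split=> [[H1 HB]|[H1 HB]].
  split=> [|u v Hu Hv]; first by have := H1; rewrite inE.
  by have := HB u v; rewrite !inE; apply.
by split=> [|u v]; rewrite !inE //; apply: HB.
Qed.

Lemma subgroupV H u : subgroup H -> H u -> H u^-1.
Proof. by move=> /subgroupP[H1 HB] /(HB 1 u H1); rewrite mul1g. Qed.

Lemma subgroupM H u v : subgroup H -> H u -> H v -> H (u * v).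
Proof.
move=> sH Hu Hv; rewrite -[v]invgK; apply: (proj2 (proj1 (subgroupP H) sH)) => //.
exact: subgroupV.
Qed.

Lemma subgroup_generated (S : set G) : subgroup (generated S).
Proof.
apply/subgroupP; split=> [K [/subgroupP[]]//|u v Su Sv K [sK SK]].
by apply: (proj2 (proj1 (subgroupP K) sK)); [apply: Su|apply: Sv].
Qed.

Lemma conj_setE g H u : conj_set g H u <-> H (g^-1 * u * g).
Proof.
split=> [[h Hh <-]|Hu]; first by rewrite !mulgA mulVg mul1g mulgVK.
by exists (g^-1 * u * g) => //; rewrite !mulgA mulgV mul1g mulgK.
Qed.

Lemma conj_set1 H : conj_set 1 H = H.
Proof. by apply/predeqP => u; rewrite conj_setE invg1 mul1g mulg1. Qed.

Lemma conj_setM g h H : conj_set g (conj_set h H) = conj_set (g * h) H.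
Proof. by apply/predeqP => u; rewrite !conj_setE invgM !mulgA. Qed.

Lemma conj_setS g H K : H `<=` K -> conj_set g H `<=` conj_set g K.
Proof. exact: image_subset. Qed.

Lemma conj_set_id g H : subgroup H -> H g -> conj_set g H = H.
Proof.
move=> sH Hg; apply/predeqP => u; rewrite conj_setE; split=> Hu.
  have -> : u = g * (g^-1 * u * g) * g^-1 by rewrite !mulgA mulgV mul1g mulgK.
  by apply: subgroupM => //; [apply: subgroupM|apply: subgroupV].
by apply: subgroupM => //; apply: subgroupM => //; apply: subgroupV.
Qed.

Lemma subgroup_conj g H : subgroup H -> subgroup (conj_set g H).
Proof.
move=> /subgroupP[H1 HB]; apply/subgroupP; split=> [|u v /conj_setE Hu /conj_setE Hv].
  by apply/conj_setE; rewrite mulg1 mulVg.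
apply/conj_setE; have := HB _ _ Hu Hv.
by rewrite !invgM invgK !mulgA mulgK.
Qed.

End Subgroups.

(** * Nested conjugates of a standard parabolic subgroup *)
Section Conjugates.
Variables (Gamma : labeled_graph).
Local Notation V := (vertex Gamma).
Local Notation g := (@cox_gen Gamma).
Local Notation A := (artin Gamma).
Local Notation word_of := (@artin_word Gamma).

Lemma artin_word_in (X : {set V}) u :
  all (fun a => a.1 \in X) u -> standard_parabolic X (word_of u).
Proof.
have sX := subgroup_generated [set artin_gen v | v in [set` X]].
elim: u => [_|[x b] u IH /= /andP[xX /IH uX]]; first by have /subgroupP[] := sX.
rewrite -cat1s artin_wordM; apply: (subgroupM sX _ uX).
have gX : standard_parabolic X (artin_gen x) by apply: sub_gen_smallest; exists x.
case: b => //; have <- : (artin_gen x)^-1 = word_of [:: (x, false)].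
  exact/mulg1_eq/artin_word_cancel.
exact: subgroupV sX gX.
Qed.

Lemma standard_parabolic_word (X : {set V}) :
  standard_parabolic X `<=`
  [set h | exists2 u, all (fun a => a.1 \in X) u & h = word_of u].
Proof.
apply: smallest_sub => [|_ [x xX <-]]; last by exists [:: (x, true)]; rewrite //= andbT.
apply/subgroupP; split=> [|_ _ [u uX ->] [v vX ->]]; first by exists [::].
exists (u ++ word_inv v); last first.
  by rewrite artin_wordM; congr (_ * _); apply: pres_inv_pi.
by rewrite all_cat uX /word_inv all_rev all_map.
Qed.

Variable X : {set V}.
Local Notation retract := (retract X).
Local Notation H := (standard_parabolic X).

Lemma run_retract_equivariant u (h : A) r :
  run retract u (h, r) = (h * (run retract u (1, r)).1, (run retract u (1, r)).2).
Proof.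
elim: u h r => [|[x b] u IH] h r /=; first by rewrite mulg1.
by rewrite !retractE IH (IH (1 * _)) /= mul1g mulgA.
Qed.

Lemma run_retract_std u h :
  all (fun a => a.1 \in X) u -> run retract u (h, 1) = (h * word_of u, 1).
Proof.
elim: u h => [|[x b] u IH] h /=; first by rewrite mulg1.
case/andP=> xX uX; have wx : wall X 1 x = Some x.
  rewrite /wall; case: pickP => [y|/(_ x)]; rewrite invg1 mul1g mulg1.
    by case/andP => _ /eqP/cox_gen_inj ->.
  by rewrite xX eqxx.
by rewrite retractE /turn wx IH // -mulgA -artin_wordM.
Qed.

Lemma run_retract_in u r : H (run retract u (1, r)).1.
Proof.
elim: u r => [|[x b] u IH] r.
  by have /subgroupP[] := subgroup_generated [set artin_gen v | v in [set` X]].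
rewrite [run _ _ _]/= retractE run_retract_equivariant mul1g /=.
apply: subgroupM (IH _); first exact: subgroup_generated.
rewrite /wall; case: pickP => [y /andP[yX _]|_].
  by apply: artin_word_in; rewrite /= yX.
exact: (artin_word_in (u := [::])).
Qed.

(** The state c reached by a is fixed by each x in X, which emits there the
    vertex c x c^-1 of X; finiteness of X makes this a permutation of X. *)
Lemma standard_parabolic_conj_sub (a : A) :
  conj_set a H `<=` H -> H `<=` conj_set a H.
Proof.
move=> aH; have [w aE] := pres_pi_surj a.
case wE : (run retract w (1, 1)) => [q c].
have qH : H q by have := run_retract_in w 1; rewrite wE.
have HH : subgroup H by apply: subgroup_generated.
have stuck x : x \in X -> exists2 y, wall X c x = Some y &
    conj_set a H (q * artin_gen y * q^-1).
  move=> xX; have xH : H (artin_gen x).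
    by apply: (artin_word_in (u := [:: (x, true)])); rewrite /= xX.
  have axH : conj_set a H (a * artin_gen x * a^-1) by exists (artin_gen x).
  have [u uX axE] := standard_parabolic_word (aH _ axH).
  (* Both words represent a x = (a x a^-1) a. *)
  have /word_eq_retract E :
      word_eq (@artin_relation Gamma) (w ++ [:: (x, true)]) (u ++ w).
    apply/pres_piP; rewrite -[LHS]/(word_of _) -[RHS]/(word_of _) !artin_wordM -axE.
    by rewrite aE mulgVK.
  have := E X (1, 1) (@reduced1 _ _).
  rewrite !run_cat wE run_retract_std // mul1g [RHS]run_retract_equivariant.
  rewrite wE /= retractE /turn.
  case: (wall X c x) => [y [qy]|[_ /eqP]].
    by exists y => //; rewrite -[artin_gen y]/(word_of _) qy mulgK -axE.
  rewrite -[X in _ == X]mulg1 (inj_eq (mulgI _)).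
  by rewrite (negPf (cox_gen_neq1 _)).
(* The default value is never taken on X, by [stuck]. *)
pose s x := odflt x (wall X c x).
have sX x : x \in X -> s x \in X.
  move=> xX; have [y wy _] := stuck x xX; rewrite /s wy /=.
  by move: wy; rewrite /wall; case: pickP => // z /andP[zX _] [<-].
have gs x : x \in X -> g (s x) = c * g x * c^-1.
  move=> xX; have [y wy _] := stuck x xX; rewrite /s wy /=.
  by move: wy; rewrite /wall; case: pickP => // z /andP[_ /eqP <-] [<-].
have s_inj : {in X &, injective s}.
  move=> x y xX yX /(congr1 g); rewrite !gs // => /mulIg/mulgI; exact: cox_gen_inj.
have imX : (s @: X = X)%SET.
  apply/eqP; rewrite eqEcard card_in_imset // leqnn andbT.
  by apply/fintype.subsetP => _ /imsetP[x xX ->]; apply: sX.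
have H_sub : H `<=` conj_set q^-1 (conj_set a H).
  apply: smallest_sub => [|_ [y yX <-]].
    by apply: subgroup_conj; apply: subgroup_conj.
  have : y \in (s @: X)%SET by rewrite imX.
  case/imsetP => x xX ->; have [z wz zH] := stuck x xX.
  by apply/conj_setE; rewrite invgK /s wz.
have := conj_setS (g := q) H_sub.
by rewrite conj_setM mulgV conj_set1 conj_set_id.
Qed.

End Conjugates.

(** * Minimal parabolic subgroups and intersections *)
Section Parabolics.
Variable Gamma : labeled_graph.
Local Notation V := (vertex Gamma).
Local Notation A := (artin Gamma).
Implicit Types (P Q : set A) (X : {set V}).

Definition has_type X P := exists a : A, P = conj_set a (standard_parabolic X).

Lemma same_type_sub_eq X P Q : has_type X P -> has_type X Q -> P `<=` Q -> P = Q.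
Proof.
move=> [a ->] [b ->] ab; apply/seteqP; split=> //.
have := conj_setS (g := b^-1) ab; rewrite !conj_setM mulVg conj_set1.
move=> /standard_parabolic_conj_sub/(conj_setS (g := b)).
by rewrite conj_setM mulVKg.
Qed.

(** Choose P in F with the fewest types of members of F below it.  A member Q
    below P has the same types below it, in particular that of P, so some
    member R below Q has the type of P; then R = P, and Q = P. *)
Lemma ex_minimal_parabolic (F : set (set A)) :
  F `<=` @parabolic Gamma -> F !=set0 ->
  exists2 P, F P & forall Q, F Q -> Q `<=` P -> Q = P.
Proof.
move=> Fpar [P0 FP0].
pose types P : {set {set V}} :=
  [set X | `[< exists2 Q, F Q & Q `<=` P /\ has_type X Q >]]%SET.
have typesP P X : reflect (exists2 Q, F Q & Q `<=` P /\ has_type X Q) (X \in types P).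
  by rewrite inE; apply: asboolP.
have [k] := ubnP #|types P0|; elim: k P0 FP0 => // k IH P FP kP.
have [[Q [FQ QP lt]]|no] :=
  pselect (exists Q, [/\ F Q, Q `<=` P & (#|types Q| < #|types P|)%N]).
  by apply: (IH Q) => //; apply: leq_trans lt _.
exists P => // Q FQ QP; have [a [X PE]] := Fpar P FP.
have sQP : types Q \subset types P.
  apply/fintype.subsetP => Y /typesP[R FR [RQ RY]].
  by apply/typesP; exists R => //; split=> //; apply: subset_trans QP.
have eQP : types Q = types P.
  apply/eqP; rewrite eqEcard sQP leqNgt; apply/negP => lt.
  by apply: no; exists Q.
have PX : has_type X P by exists a.
have : X \in types P by apply/typesP; exists P => //; split.
rewrite -eQP => /typesP[R FR [RQ RX]].
have RP : R = P by apply: same_type_sub_eq RX PX _; apply: subset_trans QP.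
by apply/seteqP; split=> //; rewrite -RP.
Qed.

Lemma parabolicT : @parabolic Gamma setT.
Proof.
exists 1, [set: V]%SET; rewrite conj_set1; apply/esym/seteqP; split=> // a _.
have [u ->] := pres_pi_surj a; apply: artin_word_in.
by apply/allP => x; rewrite inE.
Qed.

Lemma parabolic_bigcap (I : Type) (P : I -> set A) : classA Gamma ->
  (forall i, parabolic (P i)) -> parabolic (\bigcap_i P i).
Proof.
move=> hA Ppar.
(* The whole group belongs to F, so F is nonempty even when I is empty. *)
pose F := [set Q : set A | parabolic Q /\ \bigcap_i P i `<=` Q].
have [||Q [Qpar PQ] Qmin] := @ex_minimal_parabolic F.
- by move=> Q [].
- by exists setT; split=> //; apply: parabolicT.
suff -> : \bigcap_i P i = Q by [].
apply/seteqP; split=> // a Qa i _.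
have QE : Q `&` P i = Q.
  apply: Qmin; last exact: subIsetl.
  split; first exact: hA.
  by move=> b Pb; split; [apply: PQ|apply: Pb].
by move: Qa; rewrite -QE => -[].
Qed.

End Parabolics.

Local Close Scope group_scope.

Theorem corollary1p6 (Gamma : labeled_graph) (hA : classA Gamma) :
  (forall (I : Type) (P : I -> set (artin Gamma)),
      (forall i : I, parabolic (P i)) -> parabolic (\bigcap_i P i)) /\
  (forall B : set (artin Gamma),
      exists! P : set (artin Gamma), minimal_parabolic_containing B P).
Proof.
split=> [I P|B]; first exact: parabolic_bigcap.
pose I := {Q : set (artin Gamma) | parabolic Q /\ B `<=` Q}.
pose P := \bigcap_(Q : I) sval Q.
have Ppar : parabolic P.
  by apply: parabolic_bigcap => // -[Q []].
have BP : B `<=` P by move=> b Bb [Q [Qpar BQ]] _ /=; apply: BQ.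
have Pmin Q : parabolic Q -> B `<=` Q -> P `<=` Q.
  by move=> Qpar BQ a Pa; exact: (Pa (exist _ Q (conj Qpar BQ))) Logic.I.
exists P; split=> [|Q [Qpar BQ Qmin]].
  by split=> // Q Qpar BQ QP; apply/seteqP; split=> //; apply: Pmin.
by apply: Qmin => //; apply: Pmin.
Qed.
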